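(* Let $q$ be an odd prime and let $r\ge 2$. (a) The number of block-columns in the parity-check matrix of a shortened array code with modulus $q$, column weight $r$ and girth eight is at most $1+(q-1)/(r-1)$. (b) The number of block-columns in the parity-check matrix of a shortened array code with modulus $q$, column weight $r$ and girth ten is at most $$\frac{q+r(2r-3)+\sqrt{(q+r(2r-3))^2-4r(r-1)^3}}{2r(r-1)}.$$
   Context: For integers $a\le b$, $[a,b]=\{x\in\mathbb{Z}: a\le x\le b\}$. Let $q$ be an odd prime, $I$ the $q\times q$ identity matrix and $P\ne I$ a $q\times q$ circulant permutation matrix. Given $r\in[1,q]$ and distinct integers $a_0,\dots,a_{r-1}\in[0,q-1]$, the array code with modulus $q$ has parity-check matrix $H$ formed by an $r\times q$ array of $q\times q$ blocks, the block in block-row $i\in[0,r-1]$ and block-column $j\in[0,q-1]$ being $P^{a_i\cdot j}$; its column weight is $r$. A shortened array code is the code whose parity-check matrix is obtained from $H$ by deleting a set of block-columns. The girth of a code is the length of a shortest cycle in its Tanner graph (the bipartite graph with a vertex for each column and each row of the parity-check matrix, column and row vertices adjacent iff the corresponding entry is $1$). *)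

(* Defs.v *)
From mathcomp Require Import all_boot all_order all_fingroup all_algebra.

Set Implicit Arguments.
Unset Strict Implicit.
Unset Printing Implicit Defensive.

Import GRing.Theory.
Local Open Scope ring_scope.

(* [ucycle] also accepts closed walks [:: x; y] along a single edge and [::];
   the size condition excludes them. *)
Definition graph_cycle (T : eqType) (e : rel T) (c : seq T) : Prop :=
  (2 < size c)%N /\ ucycle e c.

Definition has_girth (T : eqType) (e : rel T) (g : nat) : Prop :=
  (exists2 c, graph_cycle e c & size c = g) /\
  (forall c, graph_cycle e c -> (g <= size c)%N).

(* Vertices: [inl] for the columns, [inr] for the rows. *)
Definition tanner (m n : nat) (H : 'M['F_2]_(m, n)) : rel ('I_n + 'I_m) :=
  fun u v => match u, v with
  | inl j, inr i | inr i, inl j => H i j == 1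
  | _, _ => false
  end.

(* [ordS] is the successor modulo n. *)
Definition circulant (R : Type) (n : nat) (P : 'M[R]_n) : Prop :=
  forall i j, P (ordS i) (ordS j) = P i j.

Definition array_mx (q r : nat) (P : 'M['F_2]_q) (a : 'I_r -> 'I_q)
    : 'M['F_2]_(\sum_(i < r) q, \sum_(j < q) q) :=
  \mxblock_(i < r, j < q) (P ^+ (a i * j)%N).

(* D is the set of deleted block-columns; the remaining ones keep their
   order. *)
Definition shortened_array_mx (q r : nat) (P : 'M['F_2]_q) (a : 'I_r -> 'I_q)
    (D : {set 'I_q})
    : 'M['F_2]_(\sum_(i < r) q, \sum_(k < #|~: D|) q) :=
  \mxblock_(i < r, k < #|~: D|) submxblock (array_mx P a) i (enum_val k).

(* Main.v *)
(** Every block of the parity-check matrix is a permutation matrix, so both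
bounds are Moore-type counts in the Tanner graph.
Two different non-backtracking walks with common endpoints and total length
less than the girth would close up to a short cycle.  Fix a column p.
Girth eight: among the q rows of a fixed block-row i0, one is adjacent to p and
(n-1)(r-1) others are reached by walks of length three whose first row is not
in i0; hence 1 + (n-1)(r-1) <= q.
Girth ten: the walks of length 0, 2 and 4 from p end at distinct columns; hence
1 + r(n-1) + r(r-1)(n-1)^2 <= nq. *)

Require Import Defs.
From mathcomp Require Import all_boot all_order all_fingroup all_algebra.
From mathcomp Require Import zify ring lra.

Set Implicit Arguments.
Unset Strict Implicit.
Unset Printing Implicit Defensive.

Import Order.TTheory GRing.Theory Num.Theory.
Local Open Scope ring_scope.

(** * Non-backtracking walks and short cycles *)

Fixpoint nonbacktracking (T : eqType) (w : seq T) : bool :=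
  if w is x :: ((_ :: z :: _) as w') then (x != z) && nonbacktracking w'
  else true.

Lemma nonbacktracking_behead (T : eqType) (x : T) (w : seq T) :
  nonbacktracking (x :: w) -> nonbacktracking w.
Proof. by case: w => [|y [|z w]] //= /andP[]. Qed.

(** The two walks overlap in the edge between [x] and [y], so any three consecutive vertices of the
    glued walk already lie in one of them. *)
Lemma nonbacktracking_catrev (T : eqType) (x y : T) (u v : seq T) :
  nonbacktracking (x :: y :: u) -> nonbacktracking (y :: x :: v) ->
  nonbacktracking (catrev u (y :: x :: v)).
Proof.
elim: u x y v => [|z u IHu] x y v // /andP[x_neq_z nb_u] nb_v.
by apply: IHu nb_u _; rewrite /= eq_sym x_neq_z.
Qed.

Lemma sorted_catrev (T : Type) (e : rel T) (x y : T) (u v : seq T) :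
  symmetric e -> path e x (y :: u) -> path e x v ->
  sorted e (catrev u (y :: x :: v)).
Proof.
move=> e_sym; elim: u x y v => [|z u IHu] x y v /= /andP[exy].
  by move=> _ xv; rewrite /= e_sym exy.
by move=> yzu xv; apply: IHu yzu _; rewrite /= e_sym exy.
Qed.

(** Pass to a suffix whose head [x] recurs in a repetition-free tail: the stretch up to the
    recurrence is a cycle. Irreflexivity rules out length one, non-backtracking length two. *)
Lemma nonuniq_walk_cycle (T : eqType) (e : rel T) (w : seq T) :
  irreflexive e -> sorted e w -> nonbacktracking w -> ~~ uniq w ->
  exists2 c, graph_cycle e c & (size c < size w)%N.
Proof.
move=> e_irr; elim: w => [//|x w IHw] xw nb_w /=.
have [uniq_w|nuniq_w _] := boolP (uniq w); last first.
  have [c c_cyc ltcw] := IHw (path_sorted xw) (nonbacktracking_behead nb_w) nuniq_w.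
  by exists c => //; apply: ltnW.
rewrite andbT negbK => x_in_w; move: xw nb_w uniq_w.
case/splitPr: x_in_w => u v xuv nb_uv uniq_uv.
exists (x :: u); last by rewrite /= size_cat /=; lia.
split.
  case: u xuv nb_uv {uniq_uv} => [|y [|z u]] //=; first by rewrite e_irr.
  by rewrite eqxx.
apply/andP; split.
  by move: xuv; rewrite /= cat_path rcons_path /= => /and3P[-> ->].
move: uniq_uv; rewrite cat_uniq /= negb_or => /and4P[-> /andP[xu _] _ _].
by rewrite xu.
Qed.

(* Both walks are listed backwards, from their common end [x]. *)
Lemma short_walk_unique (T : eqType) (e : rel T) (g : nat) (x : T)
    (u v : seq T) :
  symmetric e -> irreflexive e ->
  (forall c, graph_cycle e c -> (g <= size c)%N) ->
  path e x u -> path e x v ->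
  nonbacktracking (x :: u) -> nonbacktracking (x :: v) ->
  last x u = last x v -> (size u + size v < g)%N -> u = v.
Proof.
move=> e_sym e_irr girth_g.
(* The cycle found has fewer vertices than [w], so [w] may have as many as [g]. *)
have uniq_short w : sorted e w -> nonbacktracking w -> (size w <= g)%N -> uniq w.
  move=> w_path w_nb w_g; apply/negP => /negP.
  move=> /(nonuniq_walk_cycle e_irr w_path w_nb)[c /girth_g]; lia.
elim: u v x => [|y u IHu] [|z v] x // xu xv nb_u nb_v.
- move=> /= x_last v_lt; have := uniq_short (x :: z :: v) xv nb_v v_lt.
  by rewrite {1}x_last cons_uniq mem_last.
- move=> /= x_last u_lt; rewrite addn0 in u_lt.
  have := uniq_short (x :: y :: u) xu nb_u u_lt.
  by rewrite -{1}x_last cons_uniq mem_last.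
have [eq_yz|y_neq_z] := eqVneq y z => /= uv_last uv_lt.
  subst z; case/andP: xu xv => _ yu /andP[_ yv].
  congr (_ :: _); apply: (IHu v y) => //; last by lia.
  - exact: nonbacktracking_behead nb_u.
  - exact: nonbacktracking_behead nb_v.
(* The walks part at [x]; reversing one and appending the other gives a walk on at most [g] vertices
   that meets the common end twice. *)
have: uniq (catrev u (y :: x :: z :: v)).
  apply: uniq_short.
  - exact: sorted_catrev.
  - by apply: nonbacktracking_catrev => //=; rewrite y_neq_z.
  - by rewrite catrevE size_cat size_rev /=; lia.
rewrite -[catrev _ _]/(catrev (y :: u) (x :: z :: v)) catrevE cat_uniq.
move=> /and3P[_ /hasPn/(_ (last z v)) uv_disj _].
have := uv_disj; rewrite inE mem_last orbT => /(_ isT).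
by rewrite -uv_last /= mem_rev mem_last.
Qed.

(** * Moore-type counts for arrays of permutations *)

(* [inl (k, y)] is column y of block-column k, [inr (i, x)] is row x of
   block-row i, and the block (i, k) is the matrix of the permutation [s i k]. *)
Definition perm_graph (T : finType) (r n : nat) (s : 'I_r -> 'I_n -> {perm T})
    : rel ('I_n * T + 'I_r * T) :=
  fun u v => match u, v with
  | inl (k, y), inr (i, x) | inr (i, x), inl (k, y) => s i k x == y
  | _, _ => false
  end.

Lemma perm_graph_sym (T : finType) (r n : nat) (s : 'I_r -> 'I_n -> {perm T}) :
  symmetric (perm_graph s).
Proof. by case=> [[k y]|[i x]] [[k' y']|[i' x']]. Qed.

Lemma perm_graph_irr (T : finType) (r n : nat) (s : 'I_r -> 'I_n -> {perm T}) :
  irreflexive (perm_graph s).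
Proof. by case=> [[k y]|[i x]]. Qed.

Lemma perm_graph_girth8 (T : finType) (r n : nat)
    (s : 'I_r.+1 -> 'I_n.+1 -> {perm T}) :
  (0 < #|T|)%N -> (forall c, graph_cycle (perm_graph s) c -> (8 <= size c)%N) ->
  (1 + n * r <= #|T|)%N.
Proof.
move=> /card_gt0P[y0 _] girth_s.
pose row i k y : 'I_r.+1 * T := (i, (s i k)^-1%g y).
pose col k (ix : 'I_r.+1 * T) : 'I_n.+1 * T := (k, s ix.1 k ix.2).
pose p := (ord0 : 'I_n.+1, y0).
(* Each walk is stored with its end row in block-row [ord0]; [lift ord0] makes the inner block-row
   and block-column differ from [ord0], which prevents backtracking. *)
pose f (t : option ('I_n * 'I_r)) : T * seq ('I_n.+1 * T + 'I_r.+1 * T) :=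
  if t is Some (k, i) then
    let x1 := row (lift ord0 i) ord0 y0 in
    let y1 := col (lift ord0 k) x1 in
    ((row ord0 y1.1 y1.2).2, [:: inl y1; inr x1; inl p])
  else ((row ord0 ord0 y0).2, [:: inl p]).
have f_walk t : let w := inr (ord0 : 'I_r.+1, (f t).1) in
    [/\ path (perm_graph s) w (f t).2, nonbacktracking (w :: (f t).2),
        last w (f t).2 = inl p & (size (f t).2 <= 3)%N].
  by case: t => [[k i]|] /=; split; rewrite //= ?permKV ?eqxx.
have f_inj : injective (fun t => (f t).1).
  (* Two walks with the same end row have at most six steps together, fewer than eight. *)
  move=> t t' eq_tt'; suff: (f t).2 = (f t').2.
    case: t t' {eq_tt'} => [[k i]|] [[k' i']|] //=.
    by case=> /val_inj-> _ /val_inj->.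
  case: (f_walk t) (f_walk t') => [ft_p ft_nb ft_l ft_s] [].
  rewrite -eq_tt' => ft'_p ft'_nb ft'_l ft'_s.
  apply: (short_walk_unique (perm_graph_sym s) (perm_graph_irr s) girth_s
    ft_p ft'_p ft_nb ft'_nb); first by rewrite ft_l.
  exact: leq_trans (leq_add ft_s ft'_s) _.
by have := leq_card _ f_inj; rewrite card_option card_prod !card_ord.
Qed.

Lemma perm_graph_girth10 (T : finType) (r n : nat)
    (s : 'I_r.+1 -> 'I_n.+1 -> {perm T}) :
  (0 < #|T|)%N -> (forall c, graph_cycle (perm_graph s) c -> (10 <= size c)%N) ->
  (1 + r.+1 * n + r.+1 * n * (r * n) <= n.+1 * #|T|)%N.
Proof.
move=> /card_gt0P[y0 _] girth_s.
pose row i (ky : 'I_n.+1 * T) : 'I_r.+1 * T := (i, (s i ky.1)^-1%g ky.2).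
pose col k (ix : 'I_r.+1 * T) : 'I_n.+1 * T := (k, s ix.1 k ix.2).
pose p := (ord0 : 'I_n.+1, y0).
(* The summands index walks of length 0, 2 and 4. Each [lift] avoids the block just left, so the
   last column may return to block-column [ord0]. *)
pose f (t : unit + 'I_r.+1 * 'I_n + ('I_r.+1 * 'I_n) * ('I_r * 'I_n)) :
    ('I_n.+1 * T) * seq ('I_n.+1 * T + 'I_r.+1 * T) :=
  match t with
  | inl (inl _) => (p, [::])
  | inl (inr (i, k)) =>
    let x1 := row i p in (col (lift ord0 k) x1, [:: inr x1; inl p])
  | inr ((i, k), (i', k')) =>
    let x1 := row i p in let y1 := col (lift ord0 k) x1 in
    let x2 := row (lift i i') y1 in
    (col (lift (lift ord0 k) k') x2, [:: inr x2; inl y1; inr x1; inl p])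
  end.
have neq_inl (k k' : 'I_n.+1) y y' :
    k != k' -> (inl (k, y) : _ + 'I_r.+1 * T) != inl (k', y').
  by apply: contraNneq => -[->].
have neq_inr (i i' : 'I_r.+1) x x' :
    i != i' -> (inr (i, x) : 'I_n.+1 * T + _) != inr (i', x').
  by apply: contraNneq => -[->].
have f_walk t : let w := inl (f t).1 in
    [/\ path (perm_graph s) w (f t).2, nonbacktracking (w :: (f t).2),
        last w (f t).2 = inl p & (size (f t).2 <= 4)%N].
  case: t => [[[]|[i k]]|[[i k] [i' k']]] /=; split;
    rewrite //= ?permKV ?eqxx // ?andbT.
  by rewrite neq_inl ?neq_inr // eq_sym neq_lift.
have f_inj : injective (fun t => (f t).1).
  move=> t t' eq_tt'; suff: (f t).2 = (f t').2.
    (* The stored lists omit the end column, so its block index is read off from [eq_tt']. *)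
    move: eq_tt'.
    case: t => [[[]|[i k]]|[[i k] [i' k']]];
      case: t' => [[[]|[j l]]|[[j l] [j' l']]] //=.
    + by move=> [/val_inj-> _] [-> _].
    + move=> [eq_k' _] [eq_i' _ /val_inj eq_k _ eq_i _].
      by move: eq_k' eq_i'; rewrite eq_k eq_i;
        move=> /(can_inj (bumpK _))/val_inj-> /(can_inj (bumpK _))/val_inj->.
  case: (f_walk t) (f_walk t') => [ft_p ft_nb ft_l ft_s] [].
  rewrite -eq_tt' => ft'_p ft'_nb ft'_l ft'_s.
  apply: (short_walk_unique (perm_graph_sym s) (perm_graph_irr s) girth_s
    ft_p ft'_p ft_nb ft'_nb); first by rewrite ft_l.
  exact: leq_trans (leq_add ft_s ft'_s) _.
have := leq_card _ f_inj.
by rewrite !card_sum !card_prod !card_ord card_unit.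
Qed.

(** * From the parity-check matrix to the bounds *)

Lemma graph_cycle_map (T U : eqType) (e : rel T) (e' : rel U) (h : T -> U)
    (c : seq T) :
  injective h -> {mono h : x y / e x y >-> e' x y} ->
  graph_cycle e c -> graph_cycle e' (map h c).
Proof.
move=> h_inj h_mono [c_size /andP[c_cyc c_uniq]]; split; first by rewrite size_map.
by rewrite /ucycle (mono_cycle h_mono) c_cyc map_inj_uniq.
Qed.

Lemma is_perm_mxX (R : pzSemiRingType) (n : nat) (A : 'M[R]_n) (m : nat) :
  is_perm_mx A -> is_perm_mx (A ^+ m).
Proof.
move=> A_perm; elim: m => [|m IHm]; first exact: is_perm_mx1.
by rewrite exprS is_perm_mxMl.
Qed.

(** Powers of [P] are permutation matrices, and numbering the pairs (block, position) by
    [tagnat.Rank] carries cycles of the block graph to Tanner cycles of the same length. *)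
Lemma shortened_array_girth (q r : nat) (P : 'M['F_2]_q) (a : 'I_r -> 'I_q)
    (D : {set 'I_q}) (g : nat) :
  is_perm_mx P -> has_girth (tanner (shortened_array_mx P a D)) g ->
  exists s : 'I_r -> 'I_#|~: D| -> 'S_q,
    forall c, graph_cycle (perm_graph s) c -> (g <= size c)%N.
Proof.
move=> P_perm [_ girth_g].
pose B i (k : 'I_#|~: D|) : 'M_q := P ^+ (a i * enum_val k)%N.
have /fin_all_exists[s sP] i : exists si : 'I_#|~: D| -> 'S_q,
    forall k, B i k = perm_mx (si k).
  apply: (@fin_all_exists _ (fun=> 'S_q) (fun k sik => B i k = perm_mx sik)) => k.
  exact/is_perm_mxP/is_perm_mxX.
exists s => c c_cyc.
pose h (u : 'I_#|~: D| * 'I_q + 'I_r * 'I_q) :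
    'I_(\sum_(k < #|~: D|) q) + 'I_(\sum_(i < r) q) :=
  match u with
  | inl (k, y) => inl (tagnat.Rank k y)
  | inr (i, x) => inr (tagnat.Rank i x)
  end.
have Rank_inj (m : nat) (i i' : 'I_m) (x x' : 'I_q) :
    @tagnat.Rank m (fun=> q) i x = @tagnat.Rank m (fun=> q) i' x' ->
    (i, x) = (i', x').
  move/(congr1 val)/eqP; rewrite tagnat.eq_Rank => /andP[/eqP-> /eqP eq_x].
  by congr pair; apply: val_inj.
have h_inj : injective h.
  move=> [[k y]|[i x]] [[k' y']|[i' x']] //=.
    by move=> E; congr inl; apply: Rank_inj; apply: inl_inj E.
  by move=> E; congr inr; apply: Rank_inj; apply: inr_inj E.
have entry i k x y :
    (shortened_array_mx P a D (tagnat.Rank i x) (tagnat.Rank k y) == 1)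
    = (s i k x == y).
  have := mxblockK (fun i (k : 'I_#|~: D|) =>
    submxblock (array_mx P a) i (enum_val k)) i k.
  move=> /matrixP/(_ x y); rewrite mxE => ->.
  by rewrite mxblockK [P ^+ _](sP i k) !mxE; case: (s i k x == y).
rewrite -(size_map h); apply/girth_g/(graph_cycle_map h_inj _ c_cyc).
by move=> [[k y]|[i x]] [[k' y']|[i' x']] //=; rewrite entry.
Qed.

Theorem theorem6 (R : rcfType) (q r : nat)
    (q_prime : prime q) (q_odd : odd q) (r_range : (2 <= r <= q)%N)
    (P : 'M['F_2]_q) (P_perm : is_perm_mx P) (P_circ : circulant P)
    (P_neq1 : P <> 1%:M)
    (a : 'I_r -> 'I_q) (a_inj : injective a) (D : {set 'I_q}) :
  (has_girth (tanner (shortened_array_mx P a D)) 8 ->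
     #|~: D|%:R <= 1 + (q%:R - 1) / (r%:R - 1) :> R)
  /\
  (has_girth (tanner (shortened_array_mx P a D)) 10 ->
     #|~: D|%:R <=
       (q%:R + r%:R * (2 * r%:R - 3) +
          Num.sqrt ((q%:R + r%:R * (2 * r%:R - 3)) ^+ 2
                    - 4 * r%:R * (r%:R - 1) ^+ 3))
       / (2 * r%:R * (r%:R - 1)) :> R).
Proof.
have q_gt0 := prime_gt0 q_prime.
have q_ge1 : 1 <= q%:R :> R by rewrite ler1n.
(* From here on [r] is the column weight minus one. *)
case: r r_range a {a_inj} => [//|r] /andP[r_gt0 _] a; rewrite ltnS in r_gt0.
have r_ge1 : 1 <= r%:R :> R by rewrite ler1n.
rewrite -natr1 addrK.
split=> /(shortened_array_girth P_perm)[s].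
- case: #|~: D| s => [|n] s girth_s; first by rewrite addr_ge0 ?divr_ge0 //; lra.
  have := perm_graph_girth8 _ girth_s; rewrite card_ord => /(_ q_gt0).
  rewrite -(ler_nat R) natrD natrM => bound.
  by rewrite -natr1 addrC lerD2l ler_pdivlMr; lra.
- set b := q%:R + _; have b_ge0 : 0 <= b by rewrite /b; nra.
  case: #|~: D| s => [|n] s girth_s.
    by rewrite divr_ge0 ?addr_ge0 ?sqrtr_ge0 //; nra.
  have := perm_graph_girth10 _ girth_s; rewrite card_ord => /(_ q_gt0).
  rewrite -(ler_nat R) !(natrD, natrM) -!natr1 => bound.
  rewrite ler_pdivlMr; last by nra.
  set d := _ - _.
  (* Completing the square: the counting bound times [4 * (S + 1) * S] says that the square of the
     left side is at most [d]. *)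
  rewrite -lerBlDl; apply: le_trans (ler_norm _) _.
  rewrite -sqrtr_sqr ler_wsqrtr // /d /b.
  set N := n%:R in bound *; set Q := q%:R in bound *; set S := r%:R in bound r_ge1 *.
  rewrite -subr_ge0; set e := (X in 0 <= X).
  have -> : e = 4 * (S + 1) * S *
      ((N + 1) * Q - (1 + (S + 1) * N + (S + 1) * N * (S * N))).
    by rewrite /e; ring.
  by rewrite mulr_ge0 ?subr_ge0 //; nra.
Qed.
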